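(* Let $K$ be an algebraically closed field of characteristic $0$ and let $k,n$ be integers with $k>n\ge1$. If $\gcd(k,n)=1$, or one of $k,n$ is prime, then $\Gamma'\cap S_1(k,n)=\emptyset$.
   Context: $S_1$ is the polynomial algebra $K[X,Y]$ with the Poisson bracket $\{f,g\}=\frac{\partial f}{\partial X}\frac{\partial g}{\partial Y}-\frac{\partial f}{\partial Y}\frac{\partial g}{\partial X}$. For $k,n\in\mathbb{Z}_{\ge0}$, $S_1(k,n)$ is the set of $f=\sum a_{ij}X^iY^j\in S_1$ with $a_{kn}\ne0$ and $a_{ij}=0$ whenever $i>k$ or $j>n$. $\Gamma'=\{f\in S_1\mid\exists\, g\in S_1,\ \{f,g\}=1\}$. *)

(* Defs.v *)
From mathcomp Require Import all_boot all_order all_algebra.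
From mathcomp Require Import mpoly.

Set Implicit Arguments.
Unset Strict Implicit.
Unset Printing Implicit Defensive.

Import GRing.Theory.
Local Open Scope ring_scope.

(* In {mpoly K[2]}, the variable X is the one of index ord0 and Y the one of
   index ord_max; mono i j is the exponent of X^i Y^j. *)
Definition mono (i j : nat) : 'X_{1..2} := [multinom [tuple i; j]].

Definition dX (K : fieldType) (f : {mpoly K[2]}) : {mpoly K[2]} :=
  f^`M((ord0 : 'I_2)).

Definition dY (K : fieldType) (f : {mpoly K[2]}) : {mpoly K[2]} :=
  f^`M((ord_max : 'I_2)).

Definition poisson (K : fieldType) (f g : {mpoly K[2]}) : {mpoly K[2]} :=
  dX f * dY g - dY f * dX g.

Definition S1 (K : fieldType) (k n : nat) (f : {mpoly K[2]}) : Prop :=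
  f@_(mono k n) != 0 /\
  forall i j : nat, (k < i)%N \/ (n < j)%N -> f@_(mono i j) = 0.

Definition Gamma' (K : fieldType) (f : {mpoly K[2]}) : Prop :=
  exists g : {mpoly K[2]}, poisson f g = 1.

Fact mono_X (i j : nat) : mono i j ord0 = i.
Proof. by []. Qed.

Fact mono_Y (i j : nat) : mono i j ord_max = j.
Proof. by []. Qed.

(* Main.v *)
(* Multiplying {f,g} = 1 by XY makes it bilinear on monomials:
   X^a Y^b and X^c Y^d pair to (ad - bc) X^(a+c) Y^(b+d).  Hence extreme points P
   and Q of the supports of f and g for the same generic linear order are parallel,
   unless P + Q = (1,1).

   The top monomial of g is therefore parallel to (k,n).  Subtracting multiples
   c f^q from g we may assume that n does not divide t = deg_Y g; since t k = n d,
   this is already absurd when gcd(k,n) = 1, in particular when k is prime.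

   Let n = p be prime and translate X so that 0 is a root of the coefficient of Y^p
   in f.  The leftmost points of the top rows of f and g are parallel, so they are
   (ep,p) and (et,t) with e >= 1.  Consider the steepest edges leaving them, of slope s:
   both supports lie in s j - i <= p (s - e), resp. t (s - e).  Comparing linear terms
   in {f,g} = 1 shows that Y occurs in f or g, and this forces (p + t - 1) s > e (p + t) - 1,
   which rules out P + Q = (1,1) on these edges.  So their lowest points are parallel,
   with heights in the ratio p : t; as p does not divide t, the height in f is 0 or p.
   Height 0 would give a negative exponent of X, and height p says that neither edge
   exists, contradicting the choice of s. *)
Require Import Defs.
From mathcomp Require Import all_boot all_order all_algebra.
From mathcomp Require Import mpoly.
From mathcomp Require Import ring lra zify.

Set Implicit Arguments.
Unset Strict Implicit.
Unset Printing Implicit Defensive.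

Import Order.TTheory GRing.Theory Num.Theory.

Local Open Scope ring_scope.

(** * Exponents, coefficients and derivatives of polynomials *)

Lemma mnm2_ext (a b : 'X_{1..2}) : a ord0 = b ord0 -> a ord_max = b ord_max -> a = b.
Proof.
move=> e0 e1; apply/mnmP => i; case: i => [[|[|//]]] lti.
- by rewrite (_ : Ordinal lti = ord0) //; apply: val_inj.
- by rewrite (_ : Ordinal lti = ord_max) //; apply: val_inj.
Qed.

Lemma monoE (m : 'X_{1..2}) : mono (m ord0) (m ord_max) = m.
Proof. exact: mnm2_ext. Qed.

Lemma mono_inj i j i' j' : (mono i j == mono i' j') = (i == i') && (j == j').
Proof.
apply/eqP/andP => [e|[/eqP-> /eqP->] //].
by rewrite -(mono_X i j) -(mono_X i' j') -{2}(mono_Y i j) -(mono_Y i' j') e.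
Qed.

(** Monomials are eigenvectors of the Euler operator, so multiplying a derivative by its variable
    never enlarges the support. *)
Lemma mcoeff_theta (R : comNzRingType) n (f : {mpoly R[n]}) i a :
  ('X_i * f^`M(i))@_a = f@_a *+ a i.
Proof.
elim/mpolyind: f => [|c m p _ _ IH]; first by rewrite mderiv0 mulr0 !mcoeff0 mul0rn.
rewrite mderivD mulrDr !mcoeffD IH mulrnDl; congr (_ + _).
rewrite mderivZ -scalerAr !mcoeffZ mderivX -scalerAr mcoeffZ -mpolyXD !mcoeffX.
have [m0|m_gt0] := posnP (m i).
  have [<-|_] := eqVneq m a; first by rewrite m0 mul0r mulr0.
  by rewrite m0 mul0r !mulr0 mul0rn.
rewrite addmC submK; last by apply/mnm_lepP => j; rewrite mnm1E; case: eqP => [<-|].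
have [<-|_] := eqVneq m a; first by rewrite mulrA mulr1n mulr1 mulrC mulr_natl mulr1.
by rewrite !mulr0 mul0rn.
Qed.

Lemma mderivXn (R : comNzRingType) n i (p : {mpoly R[n]}) k :
  (p ^+ k)^`M(i) = p ^+ k.-1 * p^`M(i) *+ k.
Proof.
elim: k => [|[|k] IH]; first by rewrite expr0 mulr0n -mpolyC1 mderivC.
  by rewrite expr1 expr0 mul1r mulr1n.
rewrite exprS mderivM IH /= [in RHS]mulrSr addrC; congr (_ + _); last by rewrite mulrC.
by rewrite mulrnAr mulrA -exprS.
Qed.

Lemma mdeg2 (m : 'X_{1..2}) : mdeg m = (m ord0 + m ord_max)%N.
Proof.
rewrite mdegE big_ord_recl big_ord1; congr (_ + m _)%N; exact: val_inj.
Qed.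

Lemma prod2E (R : comNzRingType) (F : 'I_2 -> R) : \prod_i F i = F ord0 * F ord_max.
Proof. by rewrite big_ord_recl big_ord1; congr (_ * F _); apply: val_inj. Qed.

(** In the convolution sum only the term of [P] survives, since [a] determines [b]. *)
Lemma mcoeffM_unique (R : comNzRingType) n (u v : {mpoly R[n]}) (P Q : 'X_{1..n}) :
  (forall a b, u@_a != 0 -> v@_b != 0 -> (a + b = P + Q)%MM -> a = P) ->
  (u * v)@_(P + Q) = u@_P * v@_Q.
Proof.
move=> uniqPQ.
have ltP : (mdeg P < (mdeg (P + Q)).+1)%N by rewrite ltnS mdegD leq_addr.
rewrite [LHS](@mcoeff_poly_mul_lin _ _ u v (P + Q)%MM (mdeg (P + Q)).+1 (leqnn _)).
rewrite (bigD1 (BMultinom ltP)) /=; last exact: lem_addr.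
rewrite (_ : (P + Q - P)%MM = Q) ?big1 ?addr0 //; last by rewrite addmC addmK.
move=> a /andP[le_a ne_a].
have [->|ua] := eqVneq u@_a 0; first by rewrite mul0r.
have [->|va] := eqVneq v@_(P + Q - a) 0; first by rewrite mulr0.
case/eqP: ne_a; apply: val_inj; apply: uniqPQ ua va _.
by rewrite addmC submK.
Qed.

Lemma natr_inj_pchar0 (K : idomainType) : [pchar K] =i pred0 ->
  injective (fun n : nat => n%:R : K).
Proof.
move=> /pcharf0P charK0 m n; wlog le_mn : m n / (m <= n)%N.
  by move=> IH; case/orP: (leq_total m n) => /IH // {}IH /esym/IH.
move/esym/eqP; rewrite -subr_eq0 -natrB // charK0 subn_eq0 => le_nm.
by apply/eqP; rewrite eqn_leq le_mn.
Qed.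

(** * Lexicographic maxima of weights on supports *)

Section Maxima.
Variable T : eqType.
Implicit Types (s : seq T) (w : T -> rat).

Lemma seq_max w s x0 : x0 \in s ->
  exists2 x, x \in s & forall y, y \in s -> w y <= w x.
Proof.
elim: s x0 => // x s IH x0 _; case: s IH => [|z s] IH.
  by exists x; rewrite ?mem_head // => y; rewrite inE => /eqP->.
have [y ys maxy] := IH z (mem_head _ _).
have [le_xy|/ltW le_yx] := leP (w x) (w y).
  by exists y => [|t]; rewrite inE ?ys ?orbT // => /predU1P[->|/maxy].
exists x; rewrite ?mem_head // => t; rewrite inE => /predU1P[->//|/maxy le_ty].
exact: le_trans le_ty le_yx.
Qed.

Lemma seq_lex_max w1 w2 s x0 : x0 \in s ->
  exists2 x, x \in s &
    forall y, y \in s -> w1 y < w1 x \/ w1 y = w1 x /\ w2 y <= w2 x.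
Proof.
move=> /(seq_max w1)[x xs maxx].
have : x \in [seq y <- s | w1 y == w1 x] by rewrite mem_filter eqxx.
move=> /(seq_max w2)[z]; rewrite mem_filter => /andP[/eqP eq_zx zs] maxz.
exists z => // y ys; have := maxx y ys; rewrite le_eqVlt eq_zx => /predU1P[e|]; last by left.
by right; split=> //; apply: maxz; rewrite mem_filter e eqxx.
Qed.

End Maxima.

Definition wt (u v : rat) (m : 'X_{1..2}) : rat :=
  u * (m ord0)%:R + v * (m ord_max)%:R.

(** For linearly independent linear weights this is a vertex of the Newton polygon: [w1] picks a
    face and [w2] breaks ties on it. *)
Definition vertex (K : fieldType) (w1 w2 : 'X_{1..2} -> rat) (f : {mpoly K[2]}) P :=
  f@_P != 0 /\
  forall a, f@_a != 0 -> w1 a < w1 P \/ w1 a = w1 P /\ w2 a <= w2 P.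

Lemma vertex_exists (K : fieldType) w1 w2 (f : {mpoly K[2]}) :
  f != 0 -> exists P, vertex w1 w2 f P.
Proof.
move=> /mlead_supp /(seq_lex_max w1 w2)[P].
rewrite mcoeff_msupp => fP maxP; exists P; split=> // a.
by rewrite -mcoeff_msupp => /maxP.
Qed.

(** * Extreme points of the supports when {f,g} = 1 *)

Section Jacobian.
Variable K : fieldType.
Implicit Types f g : {mpoly K[2]}.

Lemma poisson_neq0 f g : poisson f g = 1 -> f != 0 /\ g != 0.
Proof.
move=> fg1; split; apply/eqP => e; move: fg1; rewrite e /poisson /dX /dY !mderiv0;
by rewrite ?mul0r ?mulr0 subrr => /esym/eqP; rewrite oner_eq0.
Qed.

Lemma poisson_mcoeff0 f g : poisson f g = 1 ->
  f@_(mono 1 0) * g@_(mono 0 1) - f@_(mono 0 1) * g@_(mono 1 0) = 1.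
Proof.
have [e0 e1] : (0 + U_(ord0))%MM = mono 1 0 /\ (0 + U_(ord_max))%MM = mono 0 1.
  by split; apply: mnm2_ext; rewrite add0m mnm1E.
move/(congr1 (mcoeff 0%MM)); rewrite /poisson /dX /dY mcoeffB !rmorphM /=.
by rewrite !mcoeff_deriv !mnm0E !mulr1n e0 e1 mcoeff1 eqxx.
Qed.

(** Powers of [f] Poisson-commute with [f]. *)
Lemma poissonBZX f g c q : poisson f (g - c *: f ^+ q) = poisson f g.
Proof.
rewrite /poisson /dX /dY !mderivB !mderivZ !mderivXn -!mul_mpolyC.
by rewrite -!(mulr_natr (_ * _^`M(_))); ring.
Qed.

Lemma S1_le k n f a : S1 k n f -> f@_a != 0 -> (a ord0 <= k)%N /\ (a ord_max <= n)%N.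
Proof.
case=> _ f0; rewrite -{1}(monoE a) => fa; split; rewrite leqNgt; apply: contraNN fa => lt.
- by rewrite f0 //; left.
- by rewrite f0 //; right.
Qed.

(** The point [(k, n)] bounds the support componentwise, and the monomial order refines the
    componentwise order. *)
Lemma mlead_S1 k n f : S1 k n f -> mlead f = mono k n.
Proof.
case=> fkn f0; apply: le_anti; apply/andP; split; last first.
  by apply: msupp_le_mlead; rewrite mcoeff_msupp.
have f_neq0 : f != 0 by apply: contraNneq fkn => ->; rewrite mcoeff0.
have := mlead_supp f_neq0; rewrite mcoeff_msupp -(monoE (mlead f)) => lead_neq0.
apply: lem_leo; apply/mnm_lepP => -[[|[|//]]] lti.
- by rewrite leqNgt; apply: contraNN lead_neq0 => lt_k; rewrite f0 //; left.
- by rewrite leqNgt; apply: contraNN lead_neq0 => lt_k; rewrite f0 //; right.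
Qed.

Lemma vertex_topright f P : vertex (wt 0 1) (wt 1 0) f P ->
  forall a, f@_a != 0 ->
  (a ord_max < P ord_max)%N \/ a ord_max = P ord_max /\ (a ord0 <= P ord0)%N.
Proof.
case=> _ maxP a /maxP; rewrite /wt !mul0r !add0r !mul1r !addr0 ltr_nat ler_nat.
by case=> [|[/eqP]]; [left|rewrite eqr_nat => /eqP; right].
Qed.

Lemma vertex_topleft f P : vertex (wt 0 1) (wt (-1) 0) f P ->
  forall a, f@_a != 0 ->
  (a ord_max < P ord_max)%N \/ a ord_max = P ord_max /\ (P ord0 <= a ord0)%N.
Proof.
case=> _ maxP a /maxP; rewrite /wt !mul0r !add0r !mul1r !addr0 !mulN1r lerN2 ltr_nat ler_nat.
by case=> [|[/eqP]]; [left|rewrite eqr_nat => /eqP; right].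
Qed.

(** The support lies on one side of the line of slope [s] through the corner [(E, n)], so
    [wt (-1) s] is maximal at that corner. *)
Lemma face_weight (w2 : 'X_{1..2} -> rat) f E n s (P : 'X_{1..2}) :
  f@_(mono E n) != 0 ->
  (forall a, f@_a != 0 -> (a ord_max < n)%N \/ a ord_max = n /\ (E <= a ord0)%N) ->
  (forall a, f@_a != 0 -> (a ord_max < n)%N ->
     E%:R - (a ord0)%:R <= s * (n%:R - (a ord_max)%:R)) ->
  vertex (wt (-1) s) w2 f P -> wt (-1) s P = s * n%:R - E%:R.
Proof.
move=> fEn topf slf [fP maxP]; apply: le_anti; apply/andP; split; last first.
  by case: (maxP _ fEn) => [|[]]; rewrite /wt mono_X mono_Y; lra.
rewrite /wt; case: (topf _ fP) => [|[-> leE]].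
  by move/(slf _ fP); lra.
by have : E%:R <= (P ord0)%:R :> rat; [rewrite ler_nat | lra].
Qed.

Hypothesis charK0 : [pchar K] =i pred0.

(** Both sides of XY{f,g} = XY are compared at [P + Q]: the left one is a nonzero scalar times the
    determinant, and characteristic 0 lifts its vanishing to the integers. *)
Lemma poisson_corner f g (P Q : 'X_{1..2}) :
  poisson f g = 1 -> f@_P != 0 -> g@_Q != 0 ->
  (forall a b, f@_a != 0 -> g@_b != 0 -> (a + b = P + Q)%MM -> a = P) ->
  (P + Q)%MM <> mono 1 1 ->
  (P ord0 * Q ord_max = P ord_max * Q ord0)%N.
Proof.
move=> fg1 fP gQ uniqPQ ne11.
pose th f i : {mpoly K[2]} := 'X_i * f^`M(i).
have thM i j : (th f i * th g j)@_(P + Q) = f@_P * g@_Q *+ (P i * Q j).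
  rewrite mcoeffM_unique ?mcoeff_theta; last first.
    move=> a b; rewrite !mcoeff_theta => fa gb; apply: uniqPQ.
    - by apply: contraNneq fa => ->; rewrite mul0rn.
    - by apply: contraNneq gb => ->; rewrite mul0rn.
  by rewrite mulrnAl mulrnAr -mulrnA mulnC.
have : (th f ord0 * th g ord_max - th f ord_max * th g ord0)@_(P + Q) = 0.
  have -> : th f ord0 * th g ord_max - th f ord_max * th g ord0 =
            'X_ord0 * 'X_ord_max * poisson f g.
    by rewrite /th /poisson /dX /dY; ring.
  rewrite fg1 mulr1 -mpolyXD mcoeffX; case: eqP => // e; case: ne11.
  by rewrite -e; apply: mnm2_ext; rewrite mnmDE !mnm1E.
rewrite mcoeffB !thM -!(mulr_natr (f@_P * g@_Q)) -mulrBr => /eqP.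
rewrite !mulf_eq0 (negbTE fP) (negbTE gQ) /=.
by rewrite subr_eq0 => /eqP /(natr_inj_pchar0 charK0) ->; rewrite mulnC.
Qed.

Lemma poisson_vertex f g (u1 v1 u2 v2 : rat) (P Q : 'X_{1..2}) :
  poisson f g = 1 -> u1 * v2 - u2 * v1 != 0 ->
  vertex (wt u1 v1) (wt u2 v2) f P -> vertex (wt u1 v1) (wt u2 v2) g Q ->
  (P + Q)%MM <> mono 1 1 ->
  (P ord0 * Q ord_max = P ord_max * Q ord0)%N.
Proof.
move=> fg1 det_neq0 [fP maxP] [gQ maxQ]; apply: (@poisson_corner f g) => // a b fa gb eab.
have wtD u v : wt u v a + wt u v b = wt u v P + wt u v Q.
  have /(congr1 (fun m : 'X_{1..2} => (m ord0)%:R : rat)) := eab.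
  have /(congr1 (fun m : 'X_{1..2} => (m ord_max)%:R : rat)) := eab.
  rewrite !mnmDE !natrD /wt => e1 e0.
  have -> : (a ord0)%:R = (P ord0)%:R + (Q ord0)%:R - (b ord0)%:R :> rat by lra.
  have -> : (a ord_max)%:R = (P ord_max)%:R + (Q ord_max)%:R - (b ord_max)%:R :> rat by lra.
  by ring.
have e1 : wt u1 v1 a = wt u1 v1 P.
  by have := wtD u1 v1; case: (maxP a fa) => [|[]]; case: (maxQ b gb) => [|[]]; lra.
have e2 : wt u2 v2 a = wt u2 v2 P.
  have := wtD u1 v1; have := wtD u2 v2.
  by case: (maxP a fa) => [|[]]; case: (maxQ b gb) => [|[]]; lra.
(* Cramer's rule recovers the coordinates of [a] from its two weights. *)
apply: mnm2_ext; apply/eqP; rewrite -(eqr_nat rat) -subr_eq0 -(mulrI_eq0 _ (mulfI det_neq0)).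
- have -> : (u1 * v2 - u2 * v1) * ((a ord0)%:R - (P ord0)%:R) =
    v2 * (wt u1 v1 a - wt u1 v1 P) - v1 * (wt u2 v2 a - wt u2 v2 P) by rewrite /wt; ring.
  by rewrite e1 e2 !subrr !mulr0 subrr.
- have -> : (u1 * v2 - u2 * v1) * ((a ord_max)%:R - (P ord_max)%:R) =
    u1 * (wt u2 v2 a - wt u2 v2 P) - u2 * (wt u1 v1 a - wt u1 v1 P) by rewrite /wt; ring.
  by rewrite e1 e2 !subrr !mulr0 subrr.
Qed.

(** The monomial order is compatible with addition, so no other pair of support points has the same
    sum as the leading monomials. *)
Lemma poisson_mlead f g : poisson f g = 1 ->
  (mlead f + mlead g)%MM <> mono 1 1 ->
  (mlead f ord0 * mlead g ord_max = mlead f ord_max * mlead g ord0)%N.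
Proof.
move=> fg1; have [f0 g0] := poisson_neq0 fg1.
apply: poisson_corner fg1 _ _ _; rewrite -?mcoeff_msupp ?mlead_supp // => a b.
rewrite -!mcoeff_msupp => /msupp_le_mlead + /msupp_le_mlead le_b eab.
rewrite le_eqVlt => /predU1P[//|lt_a].
by have := ltmc_le_add lt_a le_b; rewrite eab ltxx.
Qed.

(** * Reduction of g by powers of f, and the height of g *)

Lemma poisson_reduce k n f g : S1 k n f -> (0 < n)%N -> (1 < k)%N ->
  poisson f g = 1 ->
  exists2 h, poisson f h = 1 & ~~ (n %| mlead h ord_max)%N.
Proof.
move=> fkn n0 k1; have lf := mlead_S1 fkn.
elim/mleadrect: g => g IH fg1.
have [/dvdnP[q eq_q]|] := boolP (n %| mlead g ord_max)%N; last by exists g.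
have := poisson_mlead fg1; rewrite lf mono_X mono_Y eq_q => det0.
have {}det0 : mlead g ord0 = (k * q)%N.
  have /det0 : (mono k n + mlead g)%MM <> mono 1 1.
    by move/(congr1 (fun m : 'X_{1..2} => m ord0)); rewrite mnmDE !mono_X; lia.
  by nia.
have lgE : mlead g = (mlead f *+ q)%MM.
  by apply: mnm2_ext; rewrite mulmnE lf ?mono_X ?mono_Y // mulnC.
have lf0 : mleadc f != 0 by rewrite lf; case: fkn.
pose c := mleadc g / mleadc f ^+ q.
have fh1 : poisson f (g - c *: f ^+ q) = 1 by rewrite poissonBZX.
apply: (IH (g - c *: f ^+ q)) => //.
have [_ h0] := poisson_neq0 fh1.
have : (mlead (g - c *: f ^+ q) <= mlead g)%O.
  apply: le_trans (mleadB_le _ _) _; rewrite leUx lexx /=.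
  by apply: le_trans (mleadZ_le _ _) _; rewrite lgE mleadX_le.
(* The choice of [c] cancels the coefficient at [mlead g], so the leading monomial drops
   strictly. *)
rewrite le_eqVlt => /predU1P[e|//]; have := mleadc_eq0 (g - c *: f ^+ q).
rewrite (negbTE h0) e mcoeffB mcoeffZ {2}lgE mleadcX /c divfK ?subrr ?eqxx //.
by rewrite expf_neq0.
Qed.

(** The monomial order compares total degrees first. The top right vertex of [g] and [mlead g] both
    lie on the ray through [(k, n)], where larger degree means larger height. *)
Lemma mlead_maxY k n f g b : S1 k n f -> (0 < n)%N -> (1 < k)%N ->
  poisson f g = 1 -> g@_b != 0 -> (b ord_max <= mlead g ord_max)%N.
Proof.
move=> fkn n0 k1 fg1 gb; have [f0 g0] := poisson_neq0 fg1.
have ne11 (m : 'X_{1..2}) : (mono k n + m)%MM <> mono 1 1.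
  by move/(congr1 (fun m : 'X_{1..2} => m ord0)); rewrite mnmDE !mono_X; lia.
have := poisson_mlead fg1; rewrite (mlead_S1 fkn) mono_X mono_Y => /(_ (ne11 _)) detg.
have [P vP] := vertex_exists (wt 0 1) (wt 1 0) f0.
have [Q vQ] := vertex_exists (wt 0 1) (wt 1 0) g0.
have eP : P = mono k n.
  have [le0 le1] := S1_le fkn vP.1.
  by apply: mnm2_ext; have := vertex_topright vP fkn.1; rewrite mono_X mono_Y; lia.
have := poisson_vertex fg1 _ vP vQ; rewrite eP mono_X mono_Y => detQ.
have {}detQ := detQ isT (ne11 _).
have := vertex_topright vQ gb.
have := vertex_topright vQ; move/(_ (mlead g)); rewrite mleadc_eq0 => /(_ g0) leQ.
have : (mdeg Q <= mdeg (mlead g))%N.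
  by apply: lemc_mdeg; apply: msupp_le_mlead; rewrite mcoeff_msupp; case: vQ.
rewrite !mdeg2.
move: (mlead g ord0) (mlead g ord_max) (Q ord0) (Q ord_max) detg detQ leQ => d t q0 q1.
by nia.
Qed.

(** * Steepest edges of the Newton polygons when n is prime *)

Lemma poisson_prime k p f g : S1 k p f -> (1 < k)%N -> prime p ->
  f@_(mono 0 p) = 0 -> poisson f g = 1 -> (p %| mlead g ord_max)%N.
Proof.
move=> fkp k1 p_pr f0p fg1; apply: contraT => pNt.
have p2 := prime_gt1 p_pr; have p0 := prime_gt0 p_pr.
have [f0 g0] := poisson_neq0 fg1.
have t0 : (0 < mlead g ord_max)%N by case: posnP pNt => // ->; rewrite dvdn0.
have [P vP] := vertex_exists (wt 0 1) (wt (-1) 0) f0.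
have [Q vQ] := vertex_exists (wt 0 1) (wt (-1) 0) g0.
have eP1 : P ord_max = p.
  have := vertex_topleft vP fkp.1; have := (S1_le fkp vP.1).2.
  by rewrite mono_Y; lia.
have eQ1 : Q ord_max = mlead g ord_max.
  have := vertex_topleft vQ (a := mlead g); rewrite mleadc_eq0 => /(_ g0).
  by have := mlead_maxY fkp p0 k1 fg1 vQ.1; lia.
have detPQ : (P ord0 * Q ord_max = P ord_max * Q ord0)%N.
  apply: poisson_vertex fg1 _ vP vQ _ => //.
  by move/(congr1 (fun m : 'X_{1..2} => m ord_max)); rewrite mnmDE !mono_Y; lia.
have topP := vertex_topleft vP; have topQ := vertex_topleft vQ.
move: vP.1 vQ.1 topP topQ detPQ; rewrite -(monoE P) -(monoE Q) !mono_X !mono_Y eP1 eQ1.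
move: (mlead g ord_max) (P ord0) (Q ord0) t0 pNt => t E E' t0 pNt fP gQ topP topQ detPQ.
have /dvdnP[e eE] : (p %| E)%N.
  have : (p %| E * t)%N by rewrite detPQ dvdn_mulr.
  by rewrite Euclid_dvdM // (negbTE pNt) orbF.
(* For [e = 0] the corner would be [(0, p)], where [f] has coefficient 0. *)
have e0 : (0 < e)%N by case: posnP eE => // -> E0; rewrite E0 f0p eqxx in fP.
have eE' : E' = (e * t)%N by apply/eqP; rewrite -(eqn_pmul2l p0) -detPQ eE; lia.
subst E E'; clear detPQ.
(* [sl n a] is the slope of the edge from the corner [(e n, n)] down to [a]. *)
pose sl (n : nat) (a : 'X_{1..2}) : rat :=
  ((e * n)%:R - (a ord0)%:R) / (n%:R - (a ord_max)%:R).
pose S := [seq sl p a | a : 'X_{1..2} <- msupp f & (a ord_max < p)%N] ++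
          [seq sl t a | a : 'X_{1..2} <- msupp g & (a ord_max < t)%N].
have slE (n : nat) (a : 'X_{1..2}) : (a ord_max < n)%N ->
    sl n a * (n%:R - (a ord_max)%:R) = (e * n)%:R - (a ord0)%:R.
  by move=> lt; rewrite divfK // subr_eq0 eqr_nat; lia.
have fS a : f@_a != 0 -> (a ord_max < p)%N -> sl p a \in S.
  by move=> fa lt; rewrite mem_cat map_f // mem_filter lt mcoeff_msupp.
have gS a : g@_a != 0 -> (a ord_max < t)%N -> sl t a \in S.
  by move=> ga lt; rewrite mem_cat orbC map_f // mem_filter lt mcoeff_msupp.
(* The point (0,1) is steep enough to exceed the critical slope, at which the face
   points could sum to (1,1). *)
have crit01 n m : (1 < n)%N -> (0 < m)%N ->
    (e * (n + m))%:R - 1 < sl n (mono 0 1) * ((n + m)%:R - 1).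
  move=> n1 m0; have := slE n (mono 0 1) n1; rewrite mono_X mono_Y => slE1.
  have {slE1} -> : sl n (mono 0 1) = (e * n)%:R / (n%:R - 1).
    apply: (canRL (mulfK _)); first by rewrite subr_eq0 (eqr_nat _ n 1); lia.
    by rewrite slE1 subr0.
  have n_gt1 : 1 < n%:R :> rat by rewrite ltr1n.
  have m_gt0 : 0 < m%:R :> rat by rewrite ltr0n.
  have e_gt0 : 0 < e%:R :> rat by rewrite ltr0n.
  rewrite mulrAC ltr_pdivlMr ?subr_gt0 // !natrM natrD.
  (* With [n - 1] cleared, the inequality reduces to [1 < n + e * m]. *)
  by nra.
(* The constant term of {f,g} = 1 puts [(0, 1)] in the support of [f] or of [g]. *)
have [s0 s0S crit0] : exists2 s, s \in S & (e * (p + t))%:R - 1 < s * ((p + t)%:R - 1).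
  have [f01|f01] := eqVneq f@_(mono 0 1) 0; last first.
    by exists (sl p (mono 0 1)); [apply: fS | apply: crit01].
  have g01 : g@_(mono 0 1) != 0.
    apply/eqP => g01; have := poisson_mcoeff0 fg1.
    by rewrite f01 g01 mulr0 mul0r subrr => /esym/eqP; rewrite oner_eq0.
  (* If [t = 1], then [(0, 1)] would lie in the top row of [g], to the left of its leftmost point
     [(e, 1)]. *)
  have t1 : (1 < t)%N by have := topQ _ g01; rewrite mono_X mono_Y; nia.
  by exists (sl t (mono 0 1)); [apply: gS | rewrite addnC; apply: crit01].
have [s sS maxs] : exists2 s : rat, s \in S & forall y, y \in S -> y <= s :=
  seq_max id s0S.
have {s0 s0S crit0} crit : (e * (p + t))%:R - 1 < s * ((p + t)%:R - 1).
  apply: lt_le_trans crit0 _; apply: ler_wpM2r (maxs _ s0S).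
  by rewrite subr_ge0 ler1n; lia.
(* The second weight selects the lowest point of the face of slope [s]. *)
have [P' vP'] := vertex_exists (wt (-1) s) (wt 0 (-1)) f0.
have [Q' vQ'] := vertex_exists (wt (-1) s) (wt 0 (-1)) g0.
have wP' : wt (-1) s P' = s * p%:R - (e * p)%:R.
  apply: (face_weight fP topP _ vP') => a fa lt.
  by rewrite -(slE _ _ lt) ler_wpM2r ?subr_ge0 ?ler_nat 1?ltnW //; apply: maxs; apply: fS.
have wQ' : wt (-1) s Q' = s * t%:R - (e * t)%:R.
  apply: (face_weight gQ topQ _ vQ') => a ga lt.
  by rewrite -(slE _ _ lt) ler_wpM2r ?subr_ge0 ?ler_nat 1?ltnW //; apply: maxs; apply: gS.
have e_ge1 : 1 <= e%:R :> rat by rewrite ler1n.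
have p_ge2 : 2 <= p%:R :> rat by rewrite (ler_nat _ 2).
have t_ge1 : 1 <= t%:R :> rat by rewrite ler1n.
(* As [1 <= e], the bound [crit] gives [e * (p + t - 1) < s * (p + t - 1)]. *)
have lt_es : e%:R < s.
  by move: crit; rewrite natrM natrD; nra.
have detPQ : (P' ord0 * Q' ord_max = P' ord_max * Q' ord0)%N.
  apply: poisson_vertex fg1 _ vP' vQ' _ => //.
    by rewrite mulrNN mul0r mulr1 subr0.
  (* If the sum is [(1, 1)], adding [wP'] and [wQ'] gives [s * (p + t - 1) = e * (p + t) - 1],
     against [crit]. *)
  move=> e11; move: wP' wQ' crit; rewrite /wt natrM.
  have /(congr1 (fun m : 'X_{1..2} => (m ord0)%:R : rat)) := e11.
  have /(congr1 (fun m : 'X_{1..2} => (m ord_max)%:R : rat)) := e11.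
  rewrite !mnmDE !natrD mono_X mono_Y => e1 e0' wP' wQ'.
  have := congr1 ( *%R s) e1; lra.
have {}detPQ : (p * Q' ord_max = t * P' ord_max)%N.
  (* On the lines [i = s j - (s - e) p] and [i = s j - (s - e) t] the determinant has the factor
     [s - e]. *)
  have key : (s - e%:R) * (p%:R * (Q' ord_max)%:R - t%:R * (P' ord_max)%:R) = 0.
    have /(congr1 (fun n : nat => n%:R : rat)) := detPQ; rewrite !natrM.
    move: wP' wQ'; rewrite /wt !natrM => wP' wQ'.
    have -> : (P' ord0)%:R = s * (P' ord_max)%:R - (s * p%:R - e%:R * p%:R) by lra.
    have -> : (Q' ord0)%:R = s * (Q' ord_max)%:R - (s * t%:R - e%:R * t%:R) by lra.
    by move=> detPQ'; lra.
  move/eqP: key; rewrite mulf_eq0 !subr_eq0 gt_eqF //=.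
  by rewrite -!natrM eqr_nat => /eqP.
have eP'1 : P' ord_max = p.
  have leP : (P' ord_max <= p)%N by have := topP _ vP'.1; lia.
  have P1_gt0 : (0 < P' ord_max)%N.
    (* At height 0 the exponent of X would be [(e - s) p < 0]. *)
    case: posnP => // P1_0; move: wP'; rewrite /wt P1_0 natrM.
    by have : 0 <= (P' ord0)%:R :> rat by []; nra.
  have : (p %| t * P' ord_max)%N by rewrite -detPQ dvdn_mulr.
  rewrite Euclid_dvdM // (negbTE pNt) => /(dvdn_leq P1_gt0) leP'.
  by apply/eqP; rewrite eqn_leq leP.
have eQ'1 : Q' ord_max = t.
  by apply/eqP; rewrite -(eqn_pmul2l p0) detPQ eP'1 mulnC.
(* A point of slope [s] below [R] would tie with [R] for the first weight and beat it for the
   second. *)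
have faceE (h : {mpoly K[2]}) n R a : vertex (wt (-1) s) (wt 0 (-1)) h R -> R ord_max = n ->
    wt (-1) s R = s * n%:R - (e * n)%:R -> h@_a != 0 -> (a ord_max < n)%N -> sl n a != s.
  move=> [_ maxR] eR wR ha lt; apply/eqP => es; have := slE _ _ lt; rewrite es.
  move: lt wR; rewrite -(ltr_nat rat).
  by case: (maxR _ ha) => [|[]]; rewrite /wt eR; lra.
have : s \notin S.
  rewrite mem_cat; apply/norP; split; apply/mapP => -[a];
    rewrite mem_filter mcoeff_msupp => /andP[lt ha].
    by apply/eqP; rewrite eq_sym (faceE f p P').
  by apply/eqP; rewrite eq_sym (faceE g t Q').
by rewrite sS.
Qed.

End Jacobian.

(** * The substitution of X + c for X *)

Section Translation.
Variables (K : fieldType) (c : K).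
Implicit Types f g : {mpoly K[2]}.

Definition translateX f : {mpoly K[2]} :=
  f \mPo [tuple 'X_ord0 + c%:MP; 'X_ord_max].

Lemma translateXE f :
  translateX f = \sum_(m <- msupp f)
    f@_m *: (('X_ord0 + c%:MP) ^+ m ord0 * 'X_ord_max ^+ m ord_max).
Proof. by rewrite /translateX comp_mpolyE; apply: eq_bigr => m _; rewrite prod2E. Qed.

Lemma mpolyX2 (m : 'X_{1..2}) : 'X_[K, m] = 'X_ord0 ^+ m ord0 * 'X_ord_max ^+ m ord_max.
Proof. by rewrite mpolyXE_id prod2E. Qed.

(** Chain rule: the substitution has the identity as Jacobian matrix. *)
Lemma translateX_mderiv i f : (translateX f)^`M(i) = translateX f^`M(i).
Proof.
rewrite /translateX; elim/mpolyind: f => [|a m f _ _ IH].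
  by rewrite mderiv0 comp_mpoly0 mderiv0.
rewrite comp_mpolyD !mderivD comp_mpolyD IH; congr (_ + _).
rewrite comp_mpolyZ !mderivZ comp_mpolyZ; congr (_ *: _).
have dU (j : 'I_2) : ('X_j : {mpoly K[2]})^`M(i) = (j == i)%:R.
  rewrite mderivX mnm1E; case: eqP => [->|_]; last by rewrite scale0r.
  rewrite scale1r (_ : (U_(i) - U_(i))%MM = 0%MM) ?mpolyX0 //.
  by apply/mnmP => l; rewrite mnmBE subnn mnm0E.
rewrite (mpolyX2 m) !(rmorphM, rmorphXn) /= !mderivM !mderivXn !rmorphD /= !comp_mpolyXU /=.
rewrite mderivD mderivC addr0 !dU.
by rewrite !(rmorphM, rmorphMn, rmorphXn) /= !comp_mpolyXU /= !comp_mpoly1.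
Qed.

Lemma poisson_translateX f g : poisson f g = 1 -> poisson (translateX f) (translateX g) = 1.
Proof.
move=> fg1; rewrite /poisson /dX /dY !translateX_mderiv /translateX.
by rewrite -!rmorphM -rmorphB /= [X in X \mPo _]fg1 rmorph1.
Qed.

(** Binomial expansion of the powers of X + c; rows do not mix, as Y is fixed. *)
Lemma mcoeff_translateX f i j : (translateX f)@_(mono i j) =
  \sum_(m <- msupp f | m ord_max == j) f@_m * (c ^+ (m ord0 - i) *+ 'C(m ord0, i)).
Proof.
rewrite translateXE raddf_sum [RHS]big_mkcond; apply: eq_bigr => m _ /=.
rewrite mcoeffZ addrC exprDn mulr_suml raddf_sum /=.
have E (l : 'I_(m ord0).+1) :
  (c%:MP ^+ (m ord0 - l) * 'X_ord0 ^+ l *+ 'C(m ord0, l) * 'X_ord_max ^+ m ord_max)@_(mono i j)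
  = ((l == i :> nat) && (m ord_max == j))%:R * (c ^+ (m ord0 - l) *+ 'C(m ord0, l)).
  have -> : c%:MP ^+ (m ord0 - l) * 'X_ord0 ^+ l *+ 'C(m ord0, l) * 'X_ord_max ^+ m ord_max
    = (c ^+ (m ord0 - l) *+ 'C(m ord0, l)) *: 'X_[mono l (m ord_max)].
    rewrite (mpolyX2 (mono _ _)) mono_X mono_Y -scalerMnl -mul_mpolyC (rmorphXn (@mpolyC 2 K)).
    by rewrite mulrnAl mulrA.
  by rewrite mcoeffZ mcoeffX mono_inj mulrC.
rewrite (eq_bigr _ (fun l _ => E l)).
case: eqP => _; last by rewrite big1 ?mulr0 // => l _; rewrite andbF mul0r.
congr (_ * _); under eq_bigr => l _ do rewrite andbT.
have [lt_i|le_i] := ltnP i (m ord0).+1.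
  rewrite (bigD1 (Ordinal lt_i)) //= eqxx mul1r big1 ?addr0 // => l ne_l.
  by rewrite (_ : (l == i :> nat) = false) ?mul0r //; apply: contraNF ne_l.
rewrite bin_small // mulr0n big1 // => l _.
by rewrite (_ : (l == i :> nat) = false) ?mul0r //; have := ltn_ord l; lia.
Qed.

Lemma S1_translateX k n f : S1 k n f -> S1 k n (translateX f).
Proof.
move=> fkn; have [fkn0 f0] := fkn; split=> [|i j out]; rewrite mcoeff_translateX.
  (* Every other point of row [n] has X-exponent below [k], so its binomial coefficient vanishes. *)
  rewrite big_mkcond (bigD1_seq (mono k n)) ?mcoeff_msupp ?msupp_uniq //= mono_Y eqxx.
  rewrite mono_X subnn expr0 binn mulr1 big1_seq ?addr0 // => m.
  rewrite mcoeff_msupp => /andP[ne_m /(S1_le fkn)[le_k _]].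
  case: eqP => // mn; rewrite bin_small ?mulr0n ?mulr0 // ltn_neqAle le_k andbT.
  by apply: contraNneq ne_m => mk; rewrite -(monoE m) mk mn.
apply: big1_seq => m; rewrite mcoeff_msupp => /andP[/eqP mj /(S1_le fkn)[le_k le_n]].
by rewrite bin_small ?mulr0n ?mulr0 //; lia.
Qed.

End Translation.

Lemma S1_translate_root (K : closedFieldType) k n (f : {mpoly K[2]}) :
  S1 k n f -> (0 < k)%N -> exists c, (translateX c f)@_(mono 0 n) = 0.
Proof.
move=> fkn k0.
(* This is the coefficient of Y^n in [f]. Its term of degree [k > 0] is nonzero, so it is not
   constant, and a root of it serves as [c]. *)
pose q : {poly K} := \sum_(m <- msupp f | m ord_max == n) f@_m *: 'X^(m ord0).
have qk : q`_k = f@_(mono k n).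
  rewrite coef_sum big_mkcond (bigD1_seq (mono k n)) ?mcoeff_msupp ?msupp_uniq ?fkn.1 //=.
  rewrite mono_Y eqxx coefZ coefXn mono_X eqxx mulr1 big1_seq ?addr0 // => m /andP[ne_m _].
  case: eqP => // mn; rewrite coefZ coefXn (_ : (k == m ord0) = false) ?mulr0 //.
  apply: contraNF ne_m => /eqP mk.
  by rewrite -(monoE m) -mk mn.
have size_q : size q != 1.
  by apply: contraNneq fkn.1 => size_q; rewrite -qk nth_default // size_q.
have [c /eqP qc0] := closed_rootP _ size_q.
exists c; rewrite mcoeff_translateX -[RHS]qc0 horner_sum; apply: eq_bigr => m _.
by rewrite hornerZ hornerXn bin0 subn0.
Qed.

(** * Conclusion: n prime, or n coprime to k *)

Theorem corollary3p13 (K : closedFieldType) (charK0 : [pchar K] =i pred0)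
    (k n : nat) (lt_nk : (n < k)%N) (n_ge1 : (1 <= n)%N)
    (hkn : gcdn k n = 1%N \/ (prime k \/ prime n)) :
  ~ exists f : {mpoly K[2]}, Gamma' f /\ S1 k n f.
Proof.
case=> f [[g fg1] fkn]; have k1 : (1 < k)%N by lia.
have [c f0n] := S1_translate_root fkn (ltnW k1).
have {}fkn := S1_translateX c fkn.
have {}fg1 := poisson_translateX c fg1.
have [h fh1 nNt] := poisson_reduce charK0 fkn n_ge1 k1 fg1.
have [n_pr|nNpr] := boolP (prime n).
  by rewrite (poisson_prime charK0 fkn k1 n_pr f0n fh1) in nNt.
have co_kn : coprime n k.
  case: hkn => [gcd1|[k_pr|]]; last by rewrite (negbTE nNpr).
    by rewrite /coprime gcdnC gcd1.
  (* Here [k] is prime and [0 < n < k]. *)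
  by rewrite coprime_sym prime_coprime // gtnNdvd.
have := poisson_mlead charK0 fh1; rewrite (mlead_S1 fkn) mono_X mono_Y => det0.
have {}det0 : (k * mlead h ord_max = n * mlead h ord0)%N.
  apply: det0 => /(congr1 (fun m : 'X_{1..2} => m ord0)).
  by rewrite mnmDE !mono_X; lia.
by case/negP: nNt; rewrite -(Gauss_dvdr _ co_kn) det0 dvdn_mulr.
Qed.
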